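(* Let $R\in\operatorname{Ob}(\hat{\mathcal C})$, $n\ge 4$, $G=\mathrm{SL}_n(R)$, $\bar\rho:G\to\mathrm{GL}_n(k)$ induced by reduction $R\twoheadrightarrow k$, and $\iota:G\hookrightarrow\mathrm{GL}_n(R)$ the inclusion. Then $\iota$ is a universal lift of $\bar\rho$; in particular $R$ is the universal deformation ring of $\bar\rho$.
   Context: Let $k$ be a finite field of characteristic $p$. $\hat{\mathcal C}$ is the category of complete noetherian local commutative rings with residue field $k$, with local homomorphisms inducing the identity on $k$; $\mathfrak m_S$ is the maximal ideal of $S$. For a profinite group $G$ and continuous $\bar\rho:G\to\mathrm{GL}_n(k)$, a lift to $S\in\hat{\mathcal C}$ is a continuous $\rho:G\to\mathrm{GL}_n(S)$ reducing to $\bar\rho$; lifts $\rho,\rho'$ are strictly equivalent if $\rho'=K\rho K^{-1}$ with $K\in I+M_n(\mathfrak m_S)$; $\mathrm{Def}_{\bar\rho}(S)$ is the set of strict equivalence classes $[\rho]$, a functor via $[\rho]\mapsto[\mathrm{GL}_n(f)\circ\rho]$ ($\mathrm{GL}_n(f)$ applies $f$ entrywise). A lift $\rho$ of $\bar\rho$ to $R$ is universal if the natural transformation $\rho_*:\mathrm{Hom}_{\hat{\mathcal C}}(R,-)\to\mathrm{Def}_{\bar\rho}$, $f\mapsto[\mathrm{GL}_n(f)\circ\rho]$, is a natural isomorphism; $R$ is then the universal deformation ring. $\mathrm{SL}_n(R)$ has the profinite topology as $\varprojlim_j\mathrm{SL}_n(R/\mathfrak m_R^j)$. *)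

(* Defs.v *)
From HB Require Import structures.
From mathcomp Require Import all_boot all_order all_algebra.
Set Implicit Arguments. Unset Strict Implicit. Unset Printing Implicit Defensive.
Import GRing.Theory.
Local Open Scope ring_scope.

Section Defs.
Variable k : finFieldType.

Definition is_ideal (S : comNzRingType) (I : S -> Prop) : Prop :=
  [/\ I 0, (forall x y, I x -> I y -> I (x + y)) & (forall a x, I x -> I (a * x))].

Definition fin_gen (S : comNzRingType) (I : S -> Prop) : Prop :=
  exists s : seq S, forall x,
    I x <-> exists c : 'I_(size s) -> S, x = \sum_(i < size s) c i * s`_i.

Definition noetherian (S : comNzRingType) : Prop :=
  forall I : S -> Prop, is_ideal I -> fin_gen I.

Fixpoint ideal_pow (S : comNzRingType) (m : S -> Prop) (j : nat) : S -> Prop :=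
  match j with
  | 0 => fun _ => True
  | j'.+1 => fun x => exists s : seq (S * S),
      (forall p, p \in s -> m p.1 /\ ideal_pow m j' p.2) /\
      x = \sum_(p <- s) p.1 * p.2
  end.

Definition maxid (S : comUnitRingType) (piS : {rmorphism S -> k}) : S -> Prop :=
  fun x => piS x = 0.

Definition adic_separated (S : comUnitRingType) (piS : {rmorphism S -> k}) : Prop :=
  forall x : S, (forall j, ideal_pow (maxid piS) j x) -> x = 0.

Definition adic_complete (S : comUnitRingType) (piS : {rmorphism S -> k}) : Prop :=
  forall u : nat -> S,
    (forall j, exists N, forall a b, (N <= a)%N -> (N <= b)%N ->
        ideal_pow (maxid piS) j (u a - u b)) ->
    exists y : S, forall j, exists N, forall a, (N <= a)%N ->
        ideal_pow (maxid piS) j (y - u a).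

(* (S, piS) is an object of C^: a complete noetherian local ring whose
   maximal ideal is ker piS, with residue field identified with k via piS. *)
Definition in_Chat (S : comUnitRingType) (piS : {rmorphism S -> k}) : Prop :=
  [/\ (forall y : k, exists x : S, piS x = y),
      (forall x : S, piS x != 0 -> x \is a GRing.unit),
      noetherian S,
      adic_separated piS & adic_complete piS].

(* Morphisms of C^: ring homomorphisms inducing the identity on k
   (hence local). *)
Definition Chat_hom (R S : comUnitRingType) (piR : {rmorphism R -> k})
  (piS : {rmorphism S -> k}) (f : {rmorphism R -> S}) : Prop :=
  forall x, piS (f x) = piR x.

Definition SLn (R : comNzRingType) (n : nat) := {A : 'M[R]_n | \det A == 1}.

Definition incl_SL (R : comNzRingType) (n : nat) : SLn R n -> 'M[R]_n :=
  fun g => val g.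

Definition congr_mx (S : comUnitRingType) (piS : {rmorphism S -> k}) (n j : nat)
  (A B : 'M[S]_n) : Prop :=
  forall a b, ideal_pow (maxid piS) j (A a b - B a b).

(* Continuity for the profinite topology on SL_n(R) = lim SL_n(R/m_R^j)
   and the m_S-adic topology on GL_n(S) \subset M_n(S). *)
Definition continuous_rep (R S : comUnitRingType) (piR : {rmorphism R -> k})
  (piS : {rmorphism S -> k}) (n : nat) (rho : SLn R n -> 'M[S]_n) : Prop :=
  forall (g : SLn R n) (j : nat), exists i : nat, forall h : SLn R n,
    congr_mx piR i (val h) (val g) -> congr_mx piS j (rho h) (rho g).

Definition is_lift (R S : comUnitRingType) (piR : {rmorphism R -> k})
  (piS : {rmorphism S -> k}) (n : nat) (rho : SLn R n -> 'M[S]_n) : Prop :=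
  [/\ (forall g, rho g \in unitmx),
      (forall g h gh : SLn R n, val gh = val g *m val h -> rho gh = rho g *m rho h),
      (forall g, map_mx piS (rho g) = map_mx piR (val g))
    & continuous_rep piR piS rho].

Definition strict_equiv (R S : comUnitRingType) (piS : {rmorphism S -> k}) (n : nat)
  (rho rho' : SLn R n -> 'M[S]_n) : Prop :=
  exists K : 'M[S]_n, map_mx piS K = 1%:M /\
    forall g, rho' g = K *m rho g *m invmx K.

(* rho is a universal lift: it is a lift, and for every S in C^ the map
   Hom(R,S) -> Def(S), f |-> [GL_n(f) o rho], is a bijection. *)
Definition universal_lift (R : comUnitRingType) (piR : {rmorphism R -> k})
  (n : nat) (rho : SLn R n -> 'M[R]_n) : Prop :=
  is_lift piR piR rho /\
  forall (S : comUnitRingType) (piS : {rmorphism S -> k}), in_Chat piS ->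
    (forall rho' : SLn R n -> 'M[S]_n, is_lift piR piS rho' ->
       exists f : {rmorphism R -> S}, Chat_hom piR piS f /\
         strict_equiv piS (fun g => map_mx f (rho g)) rho') /\
    (forall f f' : {rmorphism R -> S}, Chat_hom piR piS f -> Chat_hom piR piS f' ->
       strict_equiv piS (fun g => map_mx f (rho g)) (fun g => map_mx f' (rho g)) ->
       forall x, f x = f' x).

End Defs.

(* Main.v *)
Require Import Defs.
From HB Require Import structures.
From mathcomp Require Import all_boot all_order all_algebra.
From mathcomp Require Import ring_quotient.
From Stdlib Require Import ClassicalEpsilon.
Import GRing.Theory.
Local Open Scope ring_scope.
Set Implicit Arguments. Unset Strict Implicit. Unset Printing Implicit Defensive.

(** Let [x_ij] be the image under a lift of the elementary matrix [e_ij(1)] and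
    put [a_ij = x_ij - 1].  The Steinberg relations force the [a_ij] to satisfy
    the matrix unit relations [a_ij a_jl = a_il] and [a_ij a_kl = 0]: one shows
    by induction on [t] that the defects of these relations lie in [m_S^t].
    Modulo [m_S^(t+1)] a defect in [m_S^t] cannot distinguish [a_pq] from the
    matrix unit [E_pq], so the step is linear algebra over matrix units, using
    only associativity and the Steinberg relations.  Matrix units lifting the
    standard ones are conjugate to them by some [K] congruent to [1].  After this
    conjugation [e_ij(r)] maps into the commutant of the [E_pq] with [p <> j],
    [q <> i], hence to [c (1 + s E_ij)]; commutators give [c = 1], and [r |-> s]
    is the required ring homomorphism because [SL_n] of a local ring is
    generated by elementary matrices. *)

(** * Quotients by ideals, and products with matrix units *)

Lemma ideal_quotient (S : comNzRingType) (J : S -> Prop) :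
  is_ideal J -> ~ J 1 ->
  exists (Q : comNzRingType) (pi : {rmorphism S -> Q}),
    forall x, pi x = 0 <-> J x.
Proof.
case=> J0 JD JM J1.
(* The quotient construction takes a boolean predicate, so membership in [J] is decided
   classically. *)
pose b (x : S) : bool := if excluded_middle_informative (J x) then true else false.
have bP x : reflect (J x) (b x).
  by rewrite /b; case: excluded_middle_informative => h; constructor.
have closed : idealr_closed (b : {pred S}).
  split; [exact/bP | by apply/negP => /(bP 1)/J1 |].
  by move=> y u v /bP Ju /bP Jv; apply/bP/JD => //; apply: JM.
pose I : idealr S := HB.pack b (isIdealr.Build S b closed).
pose pi : {rmorphism S -> {ideal_quot I}} := \pi_{ideal_quot I}%qT.
exists {ideal_quot I}, pi => x.
have piE0 : (pi x == 0) = (x \in I).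
  by rewrite -(rmorph0 pi) -[x in RHS]subr0 Quotient.idealrBE.
split=> [/eqP|Jx]; first by rewrite piE0 => /bP.
by apply/eqP; rewrite piE0; apply/bP.
Qed.

Section MatrixUnitEntries.
Variables (S : pzRingType) (n : nat).
Implicit Types (X : 'M[S]_n) (p q r c : 'I_n).

Lemma mulmx_deltaE X p q r c : (X *m delta_mx p q) r c = X r p *+ (c == q).
Proof.
rewrite mxE (bigD1 p) //= big1 ?addr0 => [|l /negPf lp]; rewrite mxE ?eqxx ?lp ?mulr0 //=.
by rewrite mulr_natr.
Qed.

Lemma delta_mulmxE X p q r c : (delta_mx p q *m X) r c = X q c *+ (r == p).
Proof.
rewrite mxE (bigD1 q) //= big1 ?addr0 => [|l /negPf lp]; rewrite mxE ?eqxx ?lp ?andbF ?mul0r //.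
by rewrite andbT mulr_natl.
Qed.

End MatrixUnitEntries.

Lemma ord_avoid n (s : seq 'I_n) : (size s < n)%N -> exists k, k \notin s.
Proof.
move=> ltsn; apply/existsP; rewrite -[[exists _, _]]negbK negb_exists.
apply/negP=> /forallP h.
have: (#|'I_n| <= size s)%N.
  apply: leq_trans (card_size s); apply/subset_leq_card/subsetP => x _.
  by have := h x; rewrite negbK.
by rewrite card_ord leqNgt ltsn.
Qed.

(** * The inductive step: Steinberg relations imply matrix unit relations *)

Section InfinitesimalRigidity.
Variables (S : comNzRingType) (n : nat).
Hypothesis n_ge4 : (4 <= n)%N.
Implicit Types (a : 'I_n -> 'I_n -> 'M[S]_n) (i j k l p q r c : 'I_n).

Local Notation E := (@delta_mx S n n).

(** The excluded product [e_ij e_ji] is a diagonal matrix unit, which is not one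
    of the [a_pq]. *)
Definition composable i j k l := [&& i != j, k != l & ~~ ((j == k) && (i == l))].

Definition unit_defect a i j k l := a i j *m a k l - a i l *+ (j == k).

(** The relations [x_ij x_kl = x_kl x_ij] and [x_ij x_jl = x_il x_jl x_ij]
    for [x_ij = 1 + a_ij]. *)
Definition steinberg a :=
  (forall i j k l, i != j -> k != l -> j != k -> i != l ->
     a i j *m a k l = a k l *m a i j) /\
  (forall i j l, i != j -> j != l -> i != l ->
     a i j *m a j l - a j l *m a i j =
     a i l + a i l *m a j l + a i l *m a i j + a i l *m a j l *m a i j).

(** Meant for the ring [S/m^(t+1)]: if the defects have entries in [m^t] and [a_pq] is [E_pq] modulo
    [m], then a defect times [a_pq - E_pq] has entries in [m^(t+1)] and vanishes. *)
Definition defects_see_units a :=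
  forall i j k l p q, composable i j k l -> p != q ->
    unit_defect a i j k l *m a p q = unit_defect a i j k l *m E p q /\
    a p q *m unit_defect a i j k l = E p q *m unit_defect a i j k l.

Section OneFamily.
Variable a : 'I_n -> 'I_n -> 'M[S]_n.
Hypotheses (a_st : steinberg a) (a_defect : defects_see_units a).

Let comm := proj1 a_st.
Let st := proj2 a_st.

Lemma zero_product_absorb i j k l p q :
  i != j -> k != l -> j != k -> p != q ->
  a i j *m a k l *m a p q = a i j *m a k l *m E p q /\
  a p q *m (a i j *m a k l) = E p q *m (a i j *m a k l).
Proof.
move=> ij kl /negPf jk pq.
have := @a_defect i j k l p q; rewrite /composable /unit_defect ij kl jk subr0.
exact.
Qed.

(** For [q != c] the product [a_ij a_kl a_cq] is read in two ways. It equals [a_ij a_kl E_cq], whose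
    column [q] is column [c] of [a_ij a_kl]; and since [a_kl a_cq] is itself a defect, it equals
    [E_ij a_kl a_cq], which lives in row [i]. *)
Lemma zero_product_support i j k l r c :
  i != j -> k != l -> j != k -> r != i -> c != l -> (a i j *m a k l) r c = 0.
Proof.
move=> ij kl jk ri cl.
have [q qc] : exists q, q \notin [:: c] by apply: ord_avoid; apply: leq_trans n_ge4.
rewrite inE in qc.
have cq : c != q by rewrite eq_sym.
have [absorb _] := zero_product_absorb ij kl jk cq.
have good : composable k l c q by rewrite /composable kl cq (eq_sym l) (negPf cl).
have : (a i j *m a k l *m E c q) r q = 0.
  rewrite -absorb -mulmxA.
  have -> : a k l *m a c q = unit_defect a k l c q.
    by rewrite /unit_defect eq_sym (negPf cl) subr0.
  by have [_ ->] := @a_defect k l c q i j good ij; rewrite delta_mulmxE (negPf ri).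
by rewrite mulmx_deltaE eqxx.
Qed.

(** The index conditions make [a_pq] commute with both factors. Their product cannot tell [a_pq]
    from [E_pq], so it commutes with [E_pq], and the conclusions are entries of that identity. *)
Lemma zero_product_comm i j k l p q :
  i != j -> k != l -> j != k -> p != q ->
  p != j -> q != i -> p != l -> q != k ->
  [/\ forall r, r != p -> (a i j *m a k l) r p = 0,
      forall c, c != q -> (a i j *m a k l) q c = 0 &
      (a i j *m a k l) p p = (a i j *m a k l) q q].
Proof.
move=> ij kl jk pq pj qi pl qk.
have [absr absl] := zero_product_absorb ij kl jk pq.
have com : a i j *m a k l *m E p q = E p q *m (a i j *m a k l).
  rewrite -absr -absl -mulmxA (@comm k l p q) // 1?eq_sym //.
  by rewrite !mulmxA (@comm i j p q) // 1?eq_sym.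
have ent r c : (a i j *m a k l) r p *+ (c == q) = (a i j *m a k l) q c *+ (r == p).
  by rewrite -mulmx_deltaE com delta_mulmxE.
split=> [r rp|c cq|].
- by have := ent r q; rewrite eqxx (negPf rp).
- by have := ent p c; rewrite eqxx (negPf cq).
- by have := ent p q; rewrite !eqxx.
Qed.

(** The square lives in row [i] and column [j]. Commuting with [E_pq] for [p != j], [q != i] removes
    the off-diagonal entries there except [(i,j)], and identifies the diagonal entries [(i,i)] and
    [(j,j)] with the zero entry [(l,l)]. *)
Lemma square_entry i j : i != j -> a i j *m a i j = (a i j *m a i j) i j *: E i j.
Proof.
move=> ij; have ji : j != i by rewrite eq_sym.
have [l] : exists l, l \notin [:: i; j] by apply: ord_avoid; apply: leq_trans n_ge4.
rewrite !inE negb_or => /andP[li lj].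
have il : i != l by rewrite eq_sym.
have jl : j != l by rewrite eq_sym.
have supp := zero_product_support ij ij ji.
have com p q pq pj qi := @zero_product_comm i j i j p q ij ij ji pq pj qi pj qi.
apply/matrixP=> r c; rewrite [RHS]mxE [E _ _ _ _]mxE.
have [-> /=|ri /=] := eqVneq r i; last first.
  rewrite mulr0; have [->|cj] := eqVneq c j; last exact: supp.
  have [->|rj] := eqVneq r j.
    by have [_ _ <-] := com l j lj lj ji; apply: supp.
  have ir : i != r by rewrite eq_sym.
  have [_ h _] := com i r ir ij ri.
  by rewrite h // eq_sym.
have [->|cj] := eqVneq c j; first by rewrite mulr1.
rewrite mulr0; have [->|ci] := eqVneq c i.
  by have [_ _ ->] := com i l il ij li; apply: supp.
have [h _ _] := com c j cj cj ji.
by rewrite h // eq_sym.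
Qed.

(** The factors commute, so the support lies in row [i] and column [l], but also in row [i] and
    column [j]; only row [i] remains. *)
Lemma row_product_support i j l r c : i != j -> i != l -> j != l ->
  [|| r != i | (c != j) && (c != l)] -> (a i j *m a i l) r c = 0.
Proof.
move=> ij il jl; have ji : j != i by rewrite eq_sym.
have li : l != i by rewrite eq_sym.
have supp_l := zero_product_support ij il ji.
have supp_j : forall r c, r != i -> c != j -> (a i j *m a i l) r c = 0.
  by move=> r' c'; rewrite (comm ij il ji il); apply: zero_product_support.
have [ri _|] := boolP (r != i).
  by have [->|cl] := eqVneq c l; [apply: supp_j; rewrite // eq_sym | exact: supp_l].
rewrite negbK => /eqP-> /andP[cj cl].
have [->|ci] := eqVneq c i.
  have [_ _ ->] := zero_product_comm ij il ji ij ij ji il ji.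
  exact: supp_l.
have [h _ _] := zero_product_comm ij il ji cj cj ji cl ji.
by apply: h; rewrite eq_sym.
Qed.

(* Multiply the Steinberg relation for [a_ij], [a_jl] by [a_il]. *)
Lemma row_product_entry i j l : i != j -> i != l -> j != l ->
  (a i j *m a i l) i j = (a i l *m a i l) i l.
Proof.
move=> ij il jl; have ji : j != i by rewrite eq_sym.
have li : l != i by rewrite eq_sym.
have lj : l != j by rewrite eq_sym.
have eq_t : a i j *m a i l *m a j l - a j l *m (a i j *m a i l) =
    a i l *m a i l + a i l *m a i l *m a j l + a i l *m a i l *m a i j
    + a i l *m a i l *m a j l *m a i j.
  have := congr1 (mulmx (a i l)) (st ij jl il).
  rewrite mulmxBr !mulmxDr !mulmxA => <-; congr (_ - _).
    by rewrite (comm ij il ji il).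
  by rewrite -mulmxA (comm ij il ji il) !mulmxA (comm jl il li jl).
have [tr tl] := zero_product_absorb ij il ji jl.
have [sr _] := zero_product_absorb il il li jl.
have [sr' _] := zero_product_absorb il il li ij.
move/matrixP/(_ i l): eq_t; rewrite tr tl sr sr' square_entry //.
rewrite -!scalemxAl mul_delta_mx_0 // mul_delta_mx_0 // !scaler0 mul0mx !addr0.
rewrite mxE [X in _ + X]mxE mulmx_deltaE delta_mulmxE eqxx (negPf ij) subr0 mulr1n => ->.
by rewrite scaler0 addr0 mxE [E _ _ _ _]mxE !eqxx mulr1.
Qed.

(** This is where four indices are needed: [SL_3(F_2)] has a representation on
    [Z_2^3] lifting the standard one in which [a_ij^2 = -2 a_ij]. *)
Lemma square_zero i j : i != j -> a i j *m a i j = 0.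
Proof.
move=> ij.
have [l] : exists l, l \notin [:: i; j] by apply: ord_avoid; apply: leq_trans n_ge4.
rewrite !inE negb_or => /andP[li lj].
have [k] : exists k, k \notin [:: i; j; l] by apply: ord_avoid; apply: leq_trans n_ge4.
rewrite !inE !negb_or => /and3P[ki kj kl].
have [ji il jl] : [/\ j != i, i != l & j != l] by split; rewrite eq_sym.
have [ik jk lk] : [/\ i != k, j != k & l != k] by split; rewrite eq_sym.
pose d := unit_defect a i k k j.
have dE : d = a i k *m a k j - a i j by rewrite /d /unit_defect eqxx.
have gd : composable i k k j by rewrite /composable ik kj eqxx (negPf ij).
(* By [row_product_entry] this entry is the entry [(i,l)] of [a_il a_ij]. It is read off from
   [a_il a_ik a_kj = a_il a_ij + E_il d]: the left side lives in column [j], and [E_il d]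
   contributes [d l l]. *)
rewrite square_entry //; suff -> : (a i j *m a i j) i j = 0 by rewrite scale0r.
rewrite -(row_product_entry il ij lj).
(* The Steinberg relation turns [d] into a sum of products, none of which reaches the entry
   [(l,l)]. *)
have dll : d l l = 0.
  rewrite dE; have -> : a i k *m a k j - a i j =
      a k j *m a i k + a i j *m a k j + a i j *m a i k + a i j *m a k j *m a i k.
    rewrite (canRL (subrK _) (st ik kj ij)) [LHS]addrC -!addrA addKr.
    by rewrite [RHS]addrC !addrA.
  have [absorb _] := zero_product_absorb ij kj jk ik.
  have sum0 (A B C D : 'M[S]_n) r c :
    A r c = 0 -> B r c = 0 -> C r c = 0 -> D r c = 0 -> (A + B + C + D) r c = 0.
    by rewrite !mxE => -> -> -> ->; rewrite !addr0.
  apply: sum0; rewrite ?absorb ?mulmx_deltaE ?(negPf lk) //.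
  - by apply: zero_product_support; rewrite // eq_sym.
  - by apply: zero_product_support; rewrite // eq_sym.
  - by apply: zero_product_support.
have eq_t : a i l *m a i k *m a k j = a i l *m a i j + E i l *m d.
  have [_ <-] := a_defect gd il; rewrite -/d -mulmxA dE mulmxBr addrC.
  by rewrite subrK.
have [absorb _] := zero_product_absorb il ik li kj.
move/matrixP/(_ i l): eq_t; rewrite absorb mulmx_deltaE (negPf lj) [RHS]mxE.
by rewrite delta_mulmxE eqxx mulr1n dll addr0 mulr0n => <-.
Qed.

Lemma row_product_zero i j l : i != j -> i != l -> a i j *m a i l = 0.
Proof.
move=> ij il; have [<-|jl] := eqVneq j l; first exact: square_zero.
have lj : l != j by rewrite eq_sym.
have ji : j != i by rewrite eq_sym.
apply/matrixP=> r c; rewrite [RHS]mxE.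
have [|] := boolP ([|| r != i | (c != j) && (c != l)]).
  exact: row_product_support.
rewrite negb_or negbK negb_and !negbK => /andP[/eqP-> /orP[]/eqP->].
  by rewrite row_product_entry // square_zero // mxE.
by rewrite (comm ij il ji il) row_product_entry // square_zero // mxE.
Qed.

End OneFamily.

(** Both hypotheses on [a] pass to this family, so every statement about rows yields one about
    columns. *)
Definition transpose_family a i j := (a j i)^T.

Lemma steinberg_transpose a : steinberg a -> steinberg (transpose_family a).
Proof.
rewrite /transpose_family => -[comm st]; split=> [i j k l ij kl jk il | i j l ij jl il].
  by rewrite -!trmx_mul comm // 1?eq_sym // (eq_sym k).
have [ji lj li] : [/\ j != i, l != j & l != i] by split; rewrite eq_sym.
have := st l j i lj ji li; move/(congr1 trmx).
(* In each term [a_li] is moved to the right end, so that transposition puts it first. *)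
rewrite (comm l i j i) // -mulmxA (comm l i l j) // linearB !linearD /= !trmx_mul => ->.
by congr (_ + _); rewrite addrAC.
Qed.

Lemma defects_see_units_transpose a :
  defects_see_units a -> defects_see_units (transpose_family a).
Proof.
move=> h i j k l p q /and3P[ij kl jkil] pq.
have good : composable l k j i.
  by rewrite /composable (eq_sym l k) kl (eq_sym j i) ij (eq_sym k j) (eq_sym l i).
have qp : q != p by rewrite eq_sym.
have eq_tr : unit_defect (transpose_family a) i j k l = (unit_defect a l k j i)^T.
  by rewrite /unit_defect linearB /= trmx_mul (eq_sym k); case: (j == k); rewrite ?trmx0.
have [hr hl] := h _ _ _ _ _ _ good qp.
rewrite eq_tr /transpose_family -!trmx_mul hl hr !trmx_mul !trmx_delta.
by [].
Qed.

Section TwoSided.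
Variable a : 'I_n -> 'I_n -> 'M[S]_n.
Hypotheses (a_st : steinberg a) (a_defect : defects_see_units a).

Let comm := proj1 a_st.
Let st := proj2 a_st.

Lemma column_product_zero i j k : i != k -> j != k -> a i k *m a j k = 0.
Proof.
move=> ik jk; apply: trmx_inj; rewrite trmx_mul trmx0.
apply: (row_product_zero (steinberg_transpose a_st) (defects_see_units_transpose a_defect));
by rewrite eq_sym.
Qed.

Lemma chain_product i j l : i != j -> j != l -> i != l ->
  a i j *m a j l = a i l + a j l *m a i j.
Proof.
move=> ij jl il; rewrite -[LHS](subrK (a j l *m a i j)) st //.
rewrite column_product_zero // (row_product_zero a_st a_defect) // 1?eq_sym //.
by rewrite mul0mx !addr0.
Qed.

(** Multiply [chain_product] on the right by [a_jk]: the left side then contains the vanishing row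
    product [a_jl a_jk]. *)
Lemma disjoint_product_shift i j l k : i != j -> j != l -> i != l ->
    j != k -> l != k ->
  a i l *m a j k = - (a j l *m a i j *m E j k).
Proof.
move=> ij jl il jk lk.
have lj : l != j by rewrite eq_sym.
have li : l != i by rewrite eq_sym.
have [<- _] := zero_product_absorb a_defect jl ij li jk.
apply/eqP; rewrite -addr_eq0 -mulmxDl -chain_product // -mulmxA.
by rewrite (row_product_zero a_st a_defect) // mulmx0.
Qed.

(** By the shift, [a_il a_jk] lives in column [k]; as the factors commute, it also lives in column
    [l]. *)
Lemma disjoint_product_zero i l j k :
    i != j -> j != l -> i != l -> j != k -> l != k -> i != k ->
  a i l *m a j k = 0.
Proof.
move=> ij jl il jk lk ik; apply/matrixP=> r c; rewrite [RHS]mxE.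
have [ck|ck] := eqVneq c k; last first.
  by rewrite disjoint_product_shift // mxE mulmx_deltaE (negPf ck) oppr0.
have lj : l != j by rewrite eq_sym.
rewrite (comm il jk lj ik).
rewrite disjoint_product_shift // 1?eq_sym // mxE mulmx_deltaE ck eq_sym (negPf lk).
by rewrite oppr0.
Qed.

(** For a fourth index [k], column [j] of [a_jl a_ij] is column [k] of [a_jl a_ij E_jk], which is
    [- a_il a_jk = 0]. *)
Lemma reversed_chain_column i j l r :
  i != j -> j != l -> i != l -> (a j l *m a i j) r j = 0.
Proof.
move=> ij jl il.
have [k] : exists k, k \notin [:: i; j; l] by apply: ord_avoid; apply: leq_trans n_ge4.
rewrite !inE !negb_or => /and3P[ki kj kl].
have [ik jk lk] : [/\ i != k, j != k & l != k] by split; rewrite eq_sym.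
have /matrixP/(_ r k) := disjoint_product_zero ij jl il jk lk ik.
rewrite disjoint_product_shift // mxE mulmx_deltaE eqxx [X in _ = X -> _]mxE => /eqP.
by rewrite oppr_eq0 => /eqP.
Qed.

End TwoSided.

(** The support lies in row [j] and column [j]. The column vanishes by [reversed_chain_column], the
    row by the same lemma for the transposed family. *)
Lemma reversed_chain_zero a i j l : steinberg a -> defects_see_units a ->
  i != j -> j != l -> i != l -> a j l *m a i j = 0.
Proof.
move=> a_st a_defect ij jl il.
have [ji lj li] : [/\ j != i, l != j & l != i] by split; rewrite eq_sym.
apply/matrixP=> r c; rewrite [RHS]mxE.
have [->|cj] := eqVneq c j; first exact: reversed_chain_column.
have [->|rj] := eqVneq r j; last exact: zero_product_support.
have := reversed_chain_column (steinberg_transpose a_st)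
  (defects_see_units_transpose a_defect) c lj ji li.
by rewrite /transpose_family -trmx_mul mxE.
Qed.

Lemma unit_defect_zero a i j k l : steinberg a -> defects_see_units a ->
  composable i j k l -> unit_defect a i j k l = 0.
Proof.
move=> a_st a_defect /and3P[ij kl]; rewrite /unit_defect.
have [jk|jk _] := eqVneq j k; rewrite ?subr0.
  rewrite -{k}jk in kl * => /= il.
  by rewrite mulr1n (chain_product a_st a_defect) // reversed_chain_zero // addr0 subrr.
have [ik|ik] := eqVneq i k.
  have [jl|jl] := eqVneq j l; first by rewrite -ik -jl square_zero.
  by rewrite -ik in kl *; rewrite (row_product_zero a_st a_defect).
have [<-|jl] := eqVneq j l.
  by rewrite (column_product_zero a_st a_defect) // eq_sym.
have [il|il] := eqVneq i l.
  by rewrite -il in kl *; rewrite reversed_chain_zero // eq_sym.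
by rewrite (disjoint_product_zero a_st a_defect) // eq_sym.
Qed.

End InfinitesimalRigidity.

(** * Powers of an ideal *)

Section IdealPowers.
Variables (S : comNzRingType) (m : S -> Prop).
Hypothesis m_ideal : is_ideal m.

Lemma ideal_pow_ideal t : is_ideal (ideal_pow m t).
Proof.
have [_ _ mM] := m_ideal.
case: t => [|t] //; split=> [|x y [s [s_in ->]] [s' [s'_in ->]]|a x [s [s_in ->]]].
- by exists [::]; split=> //; rewrite big_nil.
- exists (s ++ s'); split; last by rewrite big_cat.
  by move=> p; rewrite mem_cat => /orP[/s_in|/s'_in].
- exists [seq (a * p.1, p.2) | p <- s]; split.
    by move=> _ /mapP[p /s_in[mp Ip] ->]; split=> //; apply: mM.
  by rewrite big_map mulr_sumr; apply: eq_bigr => p _; rewrite mulrA.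
Qed.

Lemma ideal_sum (J : S -> Prop) (I : Type) (s : seq I) (F : I -> S) :
  is_ideal J -> (forall i, J (F i)) -> J (\sum_(i <- s) F i).
Proof. by case=> J0 JD _ JF; elim/big_ind: _. Qed.

Lemma ideal_powS_sub t x : ideal_pow m t.+1 x -> m x.
Proof.
have [m0 mD mM] := m_ideal.
case=> s [s_in ->]; elim: s s_in => [|p s IHs] s_in; first by rewrite big_nil.
rewrite big_cons; apply: mD; last by apply: IHs => q qs; apply: s_in; rewrite inE qs orbT.
by rewrite mulrC; apply: mM; have [] := s_in p (mem_head _ _).
Qed.

Lemma ideal_powS_mul t x y : m x -> ideal_pow m t y -> ideal_pow m t.+1 (x * y).
Proof.
move=> mx my; exists [:: (x, y)]; split; last by rewrite big_seq1.
by move=> p; rewrite inE => /eqP->.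
Qed.

End IdealPowers.

(** * Lifted matrix units and their conjugation to the standard ones *)

Section LiftedMatrixUnits.
Variables (k : finFieldType) (S : comUnitRingType) (piS : {rmorphism S -> k}).
Variable n : nat.
Hypothesis n_ge4 : (4 <= n)%N.
Implicit Types (a : 'I_n -> 'I_n -> 'M[S]_n) (i j l p q r c : 'I_n).

Lemma maxid_ideal : is_ideal (maxid piS).
Proof.
rewrite /maxid; split=> [|x y x0 y0|a x x0]; first exact: rmorph0.
  by rewrite rmorphD x0 y0 addr0.
by rewrite rmorphM x0 mulr0.
Qed.

Lemma unit_defect_adic a t i j l l' r c : steinberg a ->
    (forall i j, i != j -> map_mx piS (a i j) = delta_mx i j) ->
  composable i j l l' ->
  ideal_pow (maxid piS) t (unit_defect a i j l l' r c).
Proof.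
move=> [comm st] red; elim: t i j l l' r c => [|t IHt] i j l l' r c good; first exact: I.
(* The step takes place in [Q = S/m^(t+1)], where the induction hypothesis becomes
   [defects_see_units]. *)
set J := ideal_pow _ _.
have mI := maxid_ideal.
have J_ideal : is_ideal J by apply: ideal_pow_ideal.
have J1 : ~ J 1.
  move=> J1; have := ideal_powS_sub mI J1; rewrite /maxid rmorph1 => /eqP.
  by rewrite oner_eq0.
have [Q [pi piE]] := ideal_quotient J_ideal J1.
pose b i j := map_mx pi (a i j).
have defectE p q p' q' : unit_defect b p q p' q' = map_mx pi (unit_defect a p q p' q').
  by rewrite /unit_defect map_mxB map_mxM; case: (q == p'); rewrite ?map_mx0.
have b_st : steinberg b.
  split=> [p q p' q' *|p q p' *]; first by rewrite -!map_mxM comm.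
  by rewrite -!(map_mxM, map_mxB, map_mxD) st.
have absorb p q (D : 'M[S]_n) : p != q ->
    (forall r c, ideal_pow (maxid piS) t (D r c)) ->
    map_mx pi D *m b p q = map_mx pi D *m delta_mx p q /\
    b p q *m map_mx pi D = delta_mx p q *m map_mx pi D.
  move=> pq DI.
  have mN r' c' : maxid piS ((a p q - delta_mx p q) r' c').
    rewrite /maxid; have /matrixP/(_ r' c') := red p q pq.
    by rewrite !mxE rmorphB => ->; rewrite rmorph_nat subrr.
  have dE : delta_mx p q = map_mx pi (delta_mx p q) by rewrite map_delta_mx.
  rewrite dE; split; apply/eqP; rewrite -subr_eq0 -!map_mxM -map_mxB;
    rewrite -?mulmxBr -?mulmxBl; apply/eqP/matrixP=> r' c'; rewrite !mxE;
    apply/piE; apply: (ideal_sum _ J_ideal) => h.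
    by rewrite mulrC; apply: ideal_powS_mul (mN _ _) (DI _ _).
  exact: ideal_powS_mul (mN _ _) (DI _ _).
have b_defect : defects_see_units b.
  move=> p q p' q' h h' good' hh'; rewrite defectE; apply: absorb => // r' c'.
  exact: IHt.
have := unit_defect_zero n_ge4 b_st b_defect good.
by rewrite defectE => /matrixP/(_ r c); rewrite !mxE => /piE.
Qed.

Lemma unit_defect_lift a i j l l' : adic_separated piS -> steinberg a ->
    (forall i j, i != j -> map_mx piS (a i j) = delta_mx i j) ->
  composable i j l l' -> unit_defect a i j l l' = 0.
Proof.
move=> sep a_st red good; apply/matrixP=> r c; rewrite [RHS]mxE.
by apply: sep => t; apply: unit_defect_adic.
Qed.

Hypothesis loc : forall x : S, piS x != 0 -> x \is a GRing.unit.

Lemma reduction1_unitmx (K : 'M[S]_n) : map_mx piS K = 1%:M -> K \in unitmx.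
Proof.
by move=> K1; rewrite unitmxE; apply: loc; rewrite -det_map_mx K1 det1 oner_neq0.
Qed.

(** The matrices [u i] stand for column [o] of a full system of matrix units; the missing diagonal
    one is supplied by [a_oe a_eo]. Since [a_ij] sends [u j] to [u i] and kills the other [u l], the
    sum of the [u_i E_oi] intertwines the two families. *)
Lemma matrix_units_conjugate a :
    (forall i j l l', composable i j l l' -> unit_defect a i j l l' = 0) ->
    (forall i j, i != j -> map_mx piS (a i j) = delta_mx i j) ->
  exists K : 'M[S]_n, map_mx piS K = 1%:M /\
    forall i j, i != j -> a i j *m K = K *m delta_mx i j.
Proof.
move=> rel red.
have [o _] : exists o : 'I_n, o \notin [::] by apply: ord_avoid; apply: leq_trans n_ge4.
have [e] : exists e, e \notin [:: o] by apply: ord_avoid; apply: leq_trans n_ge4.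
rewrite inE => eo; have oe : o != e by rewrite eq_sym.
have chain i j l : i != j -> j != l -> i != l -> a i j *m a j l = a i l.
  move=> ij jl il; have := rel i j j l.
  rewrite /composable /unit_defect eqxx ij jl (negPf il) => /(_ isT)/eqP.
  by rewrite subr_eq0 => /eqP.
have orth i j l l' : i != j -> l != l' -> j != l -> a i j *m a l l' = 0.
  move=> ij ll' jl; have := rel i j l l'.
  by rewrite /composable /unit_defect ij ll' (negPf jl) subr0; apply.
pose u i := if i == o then a o e *m a e o else a i o.
have loop j : j != o -> a o j *m a j o = a o e *m a e o.
  move=> jo; have [->//|je] := eqVneq j e.
  by rewrite -(chain j e o) // mulmxA chain // eq_sym.
have uE i j l : i != j -> a i j *m u l = u i *+ (j == l).
  move=> ij; rewrite /u; have [->|lo] := eqVneq l o; last first.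
    have [jl|jl] := eqVneq j l; last exact: orth.
    rewrite -jl in lo *; have [->|io] := eqVneq i o; first exact: loop.
    exact: chain.
  have [jo|jo] := eqVneq j o; last by rewrite mulmxA orth // mul0mx.
  rewrite jo in ij *; rewrite (negPf ij).
  have [->|ie] := eqVneq i e; last by rewrite mulmxA !chain.
  (* No relation is available for [a_eo a_oe], so the loop at [o] is rerouted through a third
     index. *)
  have [h] : exists h, h \notin [:: o; e] by apply: ord_avoid; apply: leq_trans n_ge4.
  rewrite !inE negb_or => /andP[ho he].
  have [oh eh] : o != h /\ e != h by split; rewrite eq_sym.
  by rewrite -(loop h) // mulmxA !chain.
exists (\sum_i u i *m delta_mx o i); split.
  rewrite raddf_sum /= mx1_sum_delta; apply: eq_bigr => i _.
  rewrite map_mxM map_delta_mx /u; have [->|io] := eqVneq i o.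
    by rewrite map_mxM !red // !mul_delta_mx.
  by rewrite red // mul_delta_mx.
move=> i j ij; rewrite mulmx_sumr mulmx_suml (bigD1 j) //= big1 ?addr0; last first.
  by move=> l lj; rewrite mulmxA uE // eq_sym (negPf lj) mul0mx.
rewrite (bigD1 i) //= big1 ?addr0; last first.
  by move=> l li; rewrite -mulmxA mul_delta_mx_0 // mulmx0.
by rewrite mulmxA uE // eqxx -mulmxA mul_delta_mx.
Qed.

End LiftedMatrixUnits.

(** * Elementary matrices and their relations *)

Definition transvection (R : comNzRingType) n (i j : 'I_n) (r : R) : 'M[R]_n :=
  1%:M + r *: delta_mx i j.

Section Transvections.
Variables (R : comNzRingType) (n : nat).
Implicit Types (i j l p q : 'I_n) (r s : R) (A : 'M[R]_n).

(** Linearity in row [i]: [C] is the identity with row [i] replaced by row [j], so it has two equal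
    rows. *)
Lemma det_transvection i j r : i != j -> \det (transvection i j r) = 1.
Proof.
move=> ij; pose C : 'M[R]_n := \matrix_(p, q) ((if p == i then j else p) == q)%:R.
have C0 : \det C = 0.
  apply: (determinant_alternate ij) => q; rewrite !mxE eqxx.
  by case: ifP.
rewrite (@determinant_multilinear _ _ _ 1%:M C i 1 r) ?det1 ?C0 ?mulr0 ?mulr1 ?addr0 //.
- by apply/rowP=> q; rewrite !mxE !eqxx /= mul1r (eq_sym q).
- apply/matrixP=> p q; rewrite !mxE [lift i p == i]eq_sym (negPf (neq_lift _ _)).
  by rewrite mulr0 addr0.
- apply/matrixP=> p q; rewrite !mxE [lift i p == i]eq_sym (negPf (neq_lift _ _)).
  by rewrite mulr0 addr0.
Qed.

Lemma transvection_mulE i j r A p q :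
  (transvection i j r *m A) p q = A p q + r * A j q *+ (p == i).
Proof.
by rewrite mulmxDl mul1mx -scalemxAl 2!mxE delta_mulmxE mulrnAr.
Qed.

Lemma mulmx_transvectionE i j r A p q :
  (A *m transvection i j r) p q = A p q + r * A p i *+ (q == j).
Proof.
by rewrite mulmxDr mulmx1 -scalemxAr 2!mxE mulmx_deltaE mulrnAr.
Qed.

Lemma transvectionD i j r s : i != j ->
  transvection i j r *m transvection i j s = transvection i j (r + s).
Proof.
move=> ij; rewrite /transvection mulmxDl mul1mx mulmxDr mulmx1 -scalemxAl -scalemxAr.
by rewrite mul_delta_mx_0 1?eq_sym // !scaler0 addr0 -addrA -scalerDl [s + r]addrC.
Qed.

Lemma transvection0 i j : transvection i j (0 : R) = 1%:M.
Proof. by rewrite /transvection scale0r addr0. Qed.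

Lemma transvection_comm i j p q r s : j != p -> q != i ->
  transvection i j r *m transvection p q s = transvection p q s *m transvection i j r.
Proof.
move=> jp qi; rewrite /transvection !mulmxDl !mulmxDr !mul1mx !mulmx1.
rewrite -!scalemxAl -!scalemxAr !mul_delta_mx_0 //.
by rewrite !scaler0 !addr0 -!addrA; congr (_ + _); rewrite addrC.
Qed.

Lemma transvection_chain i j l r s : i != j -> j != l -> i != l ->
  transvection i j r *m transvection j l s =
  transvection i l (r * s) *m transvection j l s *m transvection i j r.
Proof.
move=> ij jl il; have [li lj] : l != i /\ l != j by split; rewrite eq_sym.
rewrite /transvection.
set X := r *: _; set Y := s *: _; set Z := (r * s) *: _.
have XY : X *m Y = Z by rewrite -scalemxAl -scalemxAr mul_delta_mx scalerA.
have YX : Y *m X = 0 by rewrite -scalemxAl -scalemxAr mul_delta_mx_0 // !scaler0.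
have ZY : Z *m Y = 0 by rewrite -scalemxAl -scalemxAr mul_delta_mx_0 // !scaler0.
have ZX : Z *m X = 0 by rewrite -scalemxAl -scalemxAr mul_delta_mx_0 // !scaler0.
rewrite !(mulmxDl, mulmxDr) !mul1mx !mulmx1 XY ZY YX ZX !mul0mx !addr0.
by rewrite -[RHS]addrA [Z + X]addrC.
Qed.

Inductive elementary_product : 'M[R]_n -> Prop :=
| ElementaryOne : elementary_product 1%:M
| ElementaryMul i j r A : i != j -> elementary_product A ->
    elementary_product (transvection i j r *m A).

Lemma elementary_product_det A : elementary_product A -> \det A = 1.
Proof.
elim=> [|i j r B ij _ detB]; first exact: det1.
by rewrite det_mulmx det_transvection // detB mulr1.
Qed.

(** Allows the elimination to replace [A] by a row-reduced matrix; the inverse transvection has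
    parameter [- r]. *)
Lemma elementary_product_transvection i j r A : i != j ->
  elementary_product (transvection i j r *m A) -> elementary_product A.
Proof.
move=> ij h; rewrite -[A]mul1mx -(transvection0 i j) -(addNr r) -transvectionD // -mulmxA.
exact: ElementaryMul.
Qed.

End Transvections.

Lemma map_transvection (R S : comNzRingType) (f : {rmorphism R -> S}) n (i j : 'I_n) r :
  map_mx f (transvection i j r) = transvection i j (f r).
Proof. by rewrite /transvection map_mxD map_mx1 map_mxZ map_delta_mx. Qed.

(** * Gaussian elimination: generation of [SL_n] of a local ring *)

Section LocalElimination.
Variables (k : finFieldType) (R : comUnitRingType) (piR : {rmorphism R -> k}).
Hypothesis loc : forall x : R, piR x != 0 -> x \is a GRing.unit.
Variable n : nat.
Implicit Types (A B : 'M[R]_n) (c i j p q : 'I_n).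

Definition reduced_columns (c : nat) A :=
  forall p q : 'I_n, (q < c)%N -> A p q = (p == q)%:R.

Lemma reduced_columns_transvection (c : nat) A i j r :
  (c <= j)%N -> reduced_columns c A -> reduced_columns c (transvection i j r *m A).
Proof.
move=> cj red p q qc; rewrite transvection_mulE !red //.
have [jq|_] := eqVneq j q; last by rewrite mulr0 mul0rn addr0.
by rewrite -jq ltnNge cj in qc.
Qed.

(** Induction on [s], which lists the rows whose entry in column [c] may still be nonzero; [next] is
    the elimination in the later columns. *)
Lemma clear_column c (s : seq 'I_n) A :
  (forall B, \det B = 1 -> reduced_columns c.+1 B -> elementary_product B) ->
  \det A = 1 -> reduced_columns c A -> A c c = 1 ->
  (forall p, p != c -> p \notin s -> A p c = 0) -> elementary_product A.
Proof.
move=> next; elim: s A => [|x s IHs] A detA redA Acc Apc.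
  apply: next => // p q; rewrite ltnS leq_eqVlt => /orP[/eqP/val_inj->|]; last exact: redA.
  by have [->|pc] := eqVneq p c; rewrite ?Acc // Apc.
have [xc|xc] := eqVneq x c.
  by apply: IHs => // p pc ps; apply: Apc; rewrite // inE xc negb_or pc.
apply: (@elementary_product_transvection _ _ x c (- A x c)) => //.
apply: IHs; first by rewrite det_mulmx det_transvection // mul1r.
- exact: reduced_columns_transvection.
- by rewrite transvection_mulE eq_sym (negPf xc) addr0.
- move=> p pc ps; rewrite transvection_mulE Acc mulr1.
  have [->|px] := eqVneq p x; first by rewrite mulr1n subrr.
  by rewrite mulr0n addr0 Apc // inE negb_or px.
Qed.

(** Otherwise column [c] of the reduction over [k] is a combination of the earlier columns, and [v]
    is a nonzero kernel vector of an invertible matrix. *)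
Lemma unit_in_column c A : \det A = 1 -> reduced_columns c A ->
  exists2 i : 'I_n, (c <= i)%N & A i c \is a GRing.unit.
Proof.
move=> detA redA; apply/exists_inP; apply: contraT => /exists_inPn nounit.
pose v : 'cV[k]_n := \col_l (if (l < c)%N then - piR (A l c) else (l == c)%:R).
have Bv : map_mx piR A *m v = 0.
  apply/colP=> p; rewrite !mxE (bigD1 c) //= !mxE ltnn eqxx mulr1.
  have [pc|cp] := ltnP p c.
    rewrite (bigD1 p) /=; last by rewrite neq_ltn pc.
    rewrite !mxE pc (redA p p pc) eqxx rmorph1 mul1r big1 ?addr0 ?subrr //.
    move=> l /andP[lc lp]; rewrite !mxE; case: ltnP => [ltlc|_].
      by rewrite (redA p l ltlc) eq_sym (negPf lp) rmorph0 mul0r.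
    by rewrite (negPf lc) mulr0.
  have -> : piR (A p c) = 0.
    by apply: contraNeq (nounit p cp) => /loc.
  rewrite add0r big1 // => l lc; rewrite !mxE; case: ltnP => [ltlc|_].
    rewrite (redA p l ltlc); have [pl|_] := eqVneq p l; last by rewrite rmorph0 mul0r.
    by rewrite pl leqNgt ltlc in cp.
  by rewrite (negPf lc) mulr0.
have uB : map_mx piR A \in unitmx by rewrite unitmxE det_map_mx detA rmorph1 unitr1.
have /colP/(_ c) : v = 0 by rewrite -[v]mul1mx -(mulVmx uB) -mulmxA Bv mulmx0.
by rewrite !mxE ltnn eqxx => /eqP; rewrite oner_eq0.
Qed.

Lemma reduced_elementary (d c : nat) A : (c + d)%N = n ->
  \det A = 1 -> reduced_columns c A -> elementary_product A.
Proof.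
elim: d c A => [|d IHd] c A cdn detA redA.
  suff -> : A = 1%:M by constructor.
  by apply/matrixP=> p q; rewrite redA ?mxE // -[c]addn0 cdn.
have ltcn : (c < n)%N by rewrite -cdn addnS ltnS leq_addr.
pose o := Ordinal ltcn.
have pivot1 B : \det B = 1 -> reduced_columns c B -> B o o = 1 -> elementary_product B.
  move=> detB redB Boo; apply: (@clear_column o (enum 'I_n)) => //.
    by move=> C; apply: IHd; rewrite addSnnS.
  by move=> p _; rewrite mem_enum.
have pivot_below B i : i != o -> (c <= i)%N -> B i o \is a GRing.unit ->
    \det B = 1 -> reduced_columns c B -> elementary_product B.
  move=> io ci uB detB redB.
  apply: (@elementary_product_transvection _ _ o i ((1 - B o o) / B i o)); first by rewrite eq_sym.
  apply: pivot1; first by rewrite det_mulmx det_transvection ?mul1r // eq_sym.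
    exact: reduced_columns_transvection.
  by rewrite transvection_mulE eqxx mulrVK // mulr1n addrC subrK.
(* In the last column no row below can correct the pivot, but [A] is then upper triangular and its
   determinant is the pivot. *)
have [ltScn|] := ltnP c.+1 n; last first.
  move=> lenc; apply: pivot1 => //.
  have lec p : p != o -> (p < c)%N.
    by move=> po; rewrite ltn_neqAle -val_eqE in po *; rewrite po -ltnS (leq_trans (ltn_ord p)).
  have trig : is_trig_mx A^T.
    apply/is_trig_mxP => p q pq; rewrite mxE redA ?(gtn_eqF pq) -?val_eqE ?(gtn_eqF pq) //.
    by rewrite (leq_trans pq) // -ltnS (leq_trans (ltn_ord q)).
  rewrite -detA -det_tr det_trig // (bigD1 o) //= mxE big1 ?mulr1 // => p po.
  by rewrite mxE redA ?eqxx // lec.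
have [i ci ui] := unit_in_column (c := o) detA redA.
have [io|] := eqVneq i o; last by move=> io; apply: (pivot_below _ i).
(* Rows cannot be rescaled: a unit pivot first produces a 1 in the row below, which then corrects
   the pivot. *)
rewrite io in ui; pose x := Ordinal ltScn.
have xo : x != o by rewrite -val_eqE /= gtn_eqF.
apply: (@elementary_product_transvection _ _ x o ((1 - A x o) / A o o)) => //.
apply: (pivot_below _ x) => //.
- by rewrite transvection_mulE eqxx mulrVK // mulr1n addrC subrK unitr1.
- by rewrite det_mulmx det_transvection // mul1r.
- exact: reduced_columns_transvection.
Qed.

Lemma det1_elementary A : \det A = 1 -> elementary_product A.
Proof. by move=> detA; apply: (reduced_elementary (add0n n)). Qed.

End LocalElimination.

(** * Commutator relations and commutants of matrix units *)

Lemma steinberg_of_commutators (S : comNzRingType) n (x : 'I_n -> 'I_n -> 'M[S]_n) :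
    (forall i j p q, i != j -> p != q -> j != p -> i != q ->
       x i j *m x p q = x p q *m x i j) ->
    (forall i j l, i != j -> j != l -> i != l ->
       x i j *m x j l = x i l *m x j l *m x i j) ->
  steinberg (fun i j => x i j - 1%:M).
Proof.
have expand (A B : 'M[S]_n) :
    (A - 1%:M) *m (B - 1%:M) = A *m B - (A + B - 1%:M).
  by rewrite mulmxBl !mulmxBr !mul1mx !mulmx1 -[A + B - _]addrA [in RHS]opprD [RHS]addrA.
have comm_sub (A B : 'M[S]_n) : (A - 1%:M) *m (B - 1%:M) - (B - 1%:M) *m (A - 1%:M)
    = A *m B - B *m A.
  by rewrite !expand [B + A]addrC; move: (A + B - _) => w; rewrite opprB addrA subrK.
move=> comm chain; split=> [i j p q ij pq jp iq | i j l ij jl il].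
  by apply/eqP; rewrite -subr_eq0 comm_sub comm // subrr.
(* Commutators ignore the subtraction of 1, so what remains is to expand [(x_il - 1) x_jl x_ij]. *)
rewrite comm_sub chain //.
rewrite -[X in _ - X]mul1mx mulmxA -!mulmxBl.
move: (x i l - 1%:M) (x j l) (x i j) => z b c.
rewrite -{1}(subrK 1%:M b) -{1}(subrK 1%:M c).
move: (b - 1%:M) (c - 1%:M) => {}b {}c.
rewrite mulmxDr mulmx1 mulmxDr mulmx1 !mulmxDl addrC -!addrA addrCA.
by congr (_ + (_ + _)); rewrite addrC.
Qed.

Section Commutant.
Variables (S : comNzRingType) (n : nat).
Implicit Types (X : 'M[S]_n) (i j p q : 'I_n).

Lemma commute_delta_entries X p q r c : X *m delta_mx p q = delta_mx p q *m X ->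
  X r p *+ (c == q) = X q c *+ (r == p).
Proof. by move=> com; rewrite -mulmx_deltaE com delta_mulmxE. Qed.

(** Commuting with [E_ir] leaves in row [r] only the diagonal entry [X i i]; commuting with [E_cj]
    kills the entries of row [i] outside columns [i] and [j]. *)
Lemma commutant_entry X i j : i != j ->
    (forall p q, p != q -> p != j -> q != i ->
       X *m delta_mx p q = delta_mx p q *m X) ->
  X = (X i i)%:M + X i j *: delta_mx i j.
Proof.
move=> ij com; have ji : j != i by rewrite eq_sym.
apply/matrixP=> r c; rewrite mxE [_%:M _ _]mxE [X in _ + X]mxE [delta_mx _ _ _ _]mxE.
have [->|ri] := eqVneq r i; last first.
  have ir : i != r by rewrite eq_sym.
  have := commute_delta_entries i c (com i r ir ij ri).
  by rewrite mulr0 addr0 eqxx (eq_sym c) => ->.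
have [<-|ic] := eqVneq i c; first by rewrite (negPf ij) mulr0 addr0 mulr1n.
rewrite mulr0n add0r; have [->|cj] := eqVneq c j; first by rewrite mulr1.
have ent := commute_delta_entries i j (com c j cj cj ji).
by rewrite mulr0; move: ent; rewrite eqxx (negPf ic).
Qed.

End Commutant.

(** * From a multiplicative lift to a ring homomorphism *)

Section StandardOnUnits.
Variables (k : finFieldType) (R S : comUnitRingType).
Variables (piR : {rmorphism R -> k}) (piS : {rmorphism S -> k}).
Variable n : nat.
Hypothesis n_ge4 : (4 <= n)%N.
Hypothesis locS : forall x : S, piS x != 0 -> x \is a GRing.unit.
Variable phi : 'M[R]_n -> 'M[S]_n.
Hypothesis phiM : forall A B, \det A = 1 -> \det B = 1 -> phi (A *m B) = phi A *m phi B.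
Hypothesis phi_red : forall A, \det A = 1 -> map_mx piS (phi A) = map_mx piR A.
Implicit Types (i j l p q : 'I_n) (r s : R).

Lemma phi_transvectionM i j p q r s : i != j -> p != q ->
  phi (transvection i j r *m transvection p q s) =
  phi (transvection i j r) *m phi (transvection p q s).
Proof. by move=> ij pq; rewrite phiM // det_transvection. Qed.

Lemma phi_chain i j l r s : i != j -> j != l -> i != l ->
  phi (transvection i j r) *m phi (transvection j l s) =
  phi (transvection i l (r * s)) *m phi (transvection j l s)
    *m phi (transvection i j r).
Proof.
move=> ij jl il; rewrite -phi_transvectionM // transvection_chain //.
by rewrite phiM ?phi_transvectionM // ?det_mulmx !det_transvection // mulr1.
Qed.

Lemma phi_comm i j p q r s : i != j -> p != q -> j != p -> q != i ->
  phi (transvection i j r) *m phi (transvection p q s) =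
  phi (transvection p q s) *m phi (transvection i j r).
Proof.
by move=> ij pq jp qi; rewrite -!phi_transvectionM // transvection_comm.
Qed.

Lemma standard_conjugate : adic_separated piS ->
  exists K : 'M[S]_n, map_mx piS K = 1%:M /\
    forall i j, i != j ->
      phi (transvection i j 1) *m K = K *m transvection i j 1.
Proof.
move=> sep; pose a i j := phi (transvection i j 1) - 1%:M.
have a_st : steinberg a.
  apply: steinberg_of_commutators => [i j p q ij pq jp iq | i j l ij jl il].
    by apply: phi_comm; rewrite // eq_sym.
  by rewrite phi_chain // mulr1.
have a_red i j : i != j -> map_mx piS (a i j) = delta_mx i j.
  move=> ij; rewrite map_mxB phi_red ?det_transvection // map_mx1.
  by rewrite /transvection map_mxD map_mx1 scale1r map_delta_mx addrC addKr.
have rel i j l l' := unit_defect_lift (i := i) (j := j) (l := l) (l' := l') n_ge4 sep a_st a_red.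
have [K [K1 aK]] := matrix_units_conjugate n_ge4 rel a_red.
exists K; split=> // i j ij.
rewrite -[phi _](subrK 1%:M) mulmxDl aK // mul1mx /transvection mulmxDr mulmx1.
by rewrite scale1r addrC.
Qed.

Hypothesis phi1 : forall i j, i != j -> phi (transvection i j 1) = transvection i j 1.

Lemma phi_transvection_scalar i j r : i != j ->
  let X := phi (transvection i j r) in X = (X i i)%:M + X i j *: delta_mx i j.
Proof.
move=> ij X; apply: commutant_entry => // p q pq pj qi.
have jp : j != p by rewrite eq_sym.
have := phi_comm r 1 ij pq jp qi; rewrite phi1 // /transvection scale1r.
by rewrite mulmxDr mulmxDl mulmx1 mul1mx => /addrI.
Qed.

Definition coef i j r := phi (transvection i j r) i j.

(** Let [c] and [d] be the scalars attached to [e_ih(r)] and [e_il(r)]. The entry [(i,i)] of the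
    relation [e_ih(r) e_hl(1) = e_il(r) e_hl(1) e_ih(r)] gives [c = d c], and [c] is a unit because
    it reduces to 1. *)
Lemma phi_transvection i j r : i != j ->
  phi (transvection i j r) = transvection i j (coef i j r).
Proof.
rename j into l; move=> il.
have [h] : exists h, h \notin [:: i; l] by apply: ord_avoid; apply: leq_trans n_ge4.
rewrite !inE negb_or => /andP[hi hl].
have [ih lh li] : [/\ i != h, l != h & l != i] by split; rewrite eq_sym.
have := phi_chain r 1 ih hl il; rewrite mulr1 phi1 //.
have := phi_transvection_scalar r ih; have := phi_transvection_scalar r il.
rewrite /coef /=; set X := phi (transvection i h r); set Y := phi (transvection i l r).
set c := X i i; set s := X i h; set d := Y i i; set t := Y i l.
move=> defY defX eqXY.
have uc : c \is a GRing.unit.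
  apply: locS; have /matrixP/(_ i i) := phi_red (det_transvection r ih).
  rewrite !mxE -/X -/c => ->.
  by rewrite eqxx (negPf ih) mulr0 addr0 rmorph1 oner_eq0.
have : c = d * c.
  have Xli : X l i = 0 by rewrite defX !mxE (negPf li) mulr0 addr0.
  have /matrixP/(_ i i) := eqXY.
  rewrite mulmx_transvectionE (negPf il) addr0 -/c => eq_c; rewrite [LHS]eq_c.
  rewrite defY -mulmxA mulmxDl mul_scalar_mx -scalemxAl mxE [X in X + _]mxE [X in _ + X]mxE.
  rewrite delta_mulmxE eqxx !transvection_mulE (negPf ih) (negPf lh) Xli.
  by rewrite !mulr0n !addr0 mul0rn mulr0 addr0.
rewrite -[LHS]mul1r => /(mulIr uc) d1.
by rewrite defY -d1 /transvection.
Qed.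

Lemma coefM i j l r s : i != j -> j != l -> i != l ->
  coef i l (r * s) = coef i j r * coef j l s.
Proof.
move=> ij jl il; have := phi_chain r s ij jl il.
rewrite !phi_transvection // transvection_chain // -!mulmxA => /matrixP/(_ i l).
have [li lj] : l != i /\ l != j by split; rewrite eq_sym.
rewrite !transvection_mulE eqxx (negPf lj) !addr0 => /addrI.
by rewrite !mxE eqxx (negPf li) mulr0 addr0 !mulr1 !mulr1n => ->.
Qed.

Lemma coefD i j r s : i != j -> coef i j (r + s) = coef i j r + coef i j s.
Proof.
move=> ij; have := phi_transvectionM r s ij ij.
rewrite transvectionD // !phi_transvection // transvectionD // => /matrixP/(_ i j).
by rewrite !mxE (negPf ij) !eqxx !add0r !mulr1.
Qed.

Lemma coef1 i j : i != j -> coef i j 1 = 1.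
Proof.
by move=> ij; rewrite /coef phi1 // !mxE (negPf ij) !eqxx mulr1 add0r.
Qed.

Lemma coef_row i j l r : i != j -> i != l -> coef i l r = coef i j r.
Proof.
move=> ij il; have [->//|jl] := eqVneq j l.
by rewrite -[r in LHS]mulr1 (coefM _ _ ij) // coef1 // mulr1.
Qed.

Lemma coef_column i j l r : i != l -> j != l -> coef i l r = coef j l r.
Proof.
move=> il jl; have [->//|ij] := eqVneq i j.
by rewrite -[r in LHS]mul1r (coefM _ _ ij) // coef1 // mul1r.
Qed.

(** Move to a common column [h], change the row, then move to column [q]. *)
Lemma coef_indep i j p q r : i != j -> p != q -> coef i j r = coef p q r.
Proof.
move=> ij pq.
have [h] : exists h, h \notin [:: i; p] by apply: ord_avoid; apply: leq_trans n_ge4.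
rewrite !inE negb_or => /andP[hi hp].
have [ih ph] : i != h /\ p != h by split; rewrite eq_sym.
by rewrite (coef_row _ ih) // (coef_column _ ih ph) (coef_row _ pq).
Qed.

Lemma phi_entrywise : (forall x : R, piR x != 0 -> x \is a GRing.unit) ->
  exists f : {rmorphism R -> S}, Chat_hom piR piS f /\
    forall A, \det A = 1 -> phi A = map_mx f A.
Proof.
move=> locR.
have [o _] : exists o : 'I_n, o \notin [::] by apply: ord_avoid; apply: leq_trans n_ge4.
have [e] : exists e, e \notin [:: o] by apply: ord_avoid; apply: leq_trans n_ge4.
have [h] : exists h, h \notin [:: o; e] by apply: ord_avoid; apply: leq_trans n_ge4.
rewrite !inE negb_or => /andP[ho he] eo.
have [oe oh eh] : [/\ o != e, o != h & e != h] by split; rewrite eq_sym.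
pose f := coef o e.
have f_additive : zmod_morphism f.
  move=> r s; apply/eqP; rewrite eq_sym subr_eq -coefD //.
  by rewrite subrK.
(* [coefM] involves the three positions [(o,h)], [(o,e)] and [(e,h)], which carry the same
   function. *)
have f_mult : monoid_morphism f.
  split=> [|r s]; first exact: coef1.
  by rewrite /f (coef_indep _ oe oh) (coefM _ _ oe eh oh) (coef_indep _ eh oe).
pose F : {rmorphism R -> S} := HB.pack f (GRing.isZmodMorphism.Build _ _ f f_additive)
  (GRing.isMonoidMorphism.Build _ _ f f_mult).
exists F; split.
  move=> r; have /matrixP/(_ o e) := phi_red (det_transvection r oe).
  by rewrite !mxE (negPf oe) !eqxx mulr1 add0r => <-.
move=> A /(det1_elementary locR); elim=> [|i j r B ij genB IHB].
  rewrite -(transvection0 _ o e) phi_transvection // map_transvection.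
  by rewrite -/(f 0) -/(F 0).
rewrite phiM ?det_transvection ?(elementary_product_det genB) // IHB phi_transvection //.
by rewrite map_mxM map_transvection /= /f (coef_indep _ ij oe).
Qed.

End StandardOnUnits.

(** * Universality of the inclusion *)

Lemma incl_SL_lift (k : finFieldType) (R : comUnitRingType)
  (piR : {rmorphism R -> k}) n : is_lift piR piR (@incl_SL R n).
Proof.
split=> // [g | g j]; last by exists j.
by rewrite unitmxE (eqP (valP g)) unitr1.
Qed.

Section Universality.
Variables (k : finFieldType) (R S : comUnitRingType).
Variables (piR : {rmorphism R -> k}) (piS : {rmorphism S -> k}).
Variable n : nat.
Hypothesis n_ge4 : (4 <= n)%N.
Hypothesis locS : forall x : S, piS x != 0 -> x \is a GRing.unit.

Lemma lift_strict_equiv_entrywise (rho : SLn R n -> 'M[S]_n) :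
    (forall x : R, piR x != 0 -> x \is a GRing.unit) ->
    adic_separated piS -> is_lift piR piS rho ->
  exists f : {rmorphism R -> S}, Chat_hom piR piS f /\
    strict_equiv piS (fun g => map_mx f (incl_SL g)) rho.
Proof.
move=> locR sepS [_ rhoM rho_red _].
(* Extending [rho] by 0 allows work with plain matrices; [phi] is only evaluated at determinant
   1. *)
pose phi (A : 'M[R]_n) := if insub A is Some g then rho g else 0.
have phiE g : phi (val g) = rho g by rewrite /phi valK.
have SL A : \det A = 1 -> exists g : SLn R n, val g = A.
  by move=> /eqP detA; exists (exist _ A detA).
have phiM A B : \det A = 1 -> \det B = 1 -> phi (A *m B) = phi A *m phi B.
  move=> detA detB; have [gh defgh] : exists gh : SLn R n, val gh = A *m B.
    by apply: SL; rewrite det_mulmx detA detB mulr1.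
  have [[g Eg] [h Eh]] := (SL A detA, SL B detB).
  by rewrite -defgh -Eg -Eh !phiE; apply: rhoM; rewrite defgh Eg Eh.
have phi_red A : \det A = 1 -> map_mx piS (phi A) = map_mx piR A.
  by move/SL=> [g <-]; rewrite phiE.
have [K [K1 phiK]] := standard_conjugate n_ge4 phiM phi_red sepS.
have uK := reduction1_unitmx locS K1.
pose psi A := invmx K *m phi A *m K.
have psiM A B : \det A = 1 -> \det B = 1 -> psi (A *m B) = psi A *m psi B.
  by move=> detA detB; rewrite /psi phiM // !mulmxA mulmxK.
have psi_red A : \det A = 1 -> map_mx piS (psi A) = map_mx piR A.
  move=> detA; have -> : psi A = invmx K *m phi A *m K by [].
  have invK1 : map_mx piS (invmx K) = 1%:M.
    by rewrite -[LHS]mul1mx -K1 -map_mxM mulmxV // map_mx1.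
  by rewrite !map_mxM invK1 K1 mul1mx mulmx1 phi_red.
have psi1 (i j : 'I_n) : i != j -> psi (transvection i j 1) = transvection i j 1.
  by move=> ij; rewrite /psi -mulmxA phiK // mulKmx.
have [f [f_hom psiE]] := phi_entrywise n_ge4 locS psiM psi_red psi1 locR.
exists f; split=> //; exists K; split=> // g.
by rewrite -psiE ?(eqP (valP g)) // /psi phiE -mulmxA mulmxK // mulKVmx.
Qed.

(** The entry [(o,e)] of the conjugation identity at [e_oe(s)] is [K_oo f(s) = f'(s) K_ee]. Taking
    [s = 1] gives [K_oo = K_ee], a unit since [K] reduces to 1. *)
Lemma strict_equiv_entrywise_inj (f f' : {rmorphism R -> S}) :
    strict_equiv piS (fun g => map_mx f (@incl_SL R n g)) (fun g => map_mx f' (incl_SL g)) ->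
  f =1 f'.
Proof.
case=> K [K1 eqK] r.
have uK := reduction1_unitmx locS K1.
have [o _] : exists o : 'I_n, o \notin [::] by apply: ord_avoid; apply: leq_trans n_ge4.
have [e] : exists e, e \notin [:: o] by apply: ord_avoid; apply: leq_trans n_ge4.
rewrite inE eq_sym => oe.
have com s : K *m transvection o e (f s) = transvection o e (f' s) *m K.
  have /eqP det_s := det_transvection s oe.
  have := eqK (exist (fun A : 'M[R]_n => \det A == 1) _ det_s).
  by rewrite /incl_SL /= !map_transvection => ->; rewrite mulmxKV.
have ent s : K o o * f s = f' s * K e e.
  have /matrixP/(_ o e) := com s.
  rewrite mulmx_transvectionE transvection_mulE !eqxx.
  by move/addrI; rewrite mulrC.
have uKo : K o o \is a GRing.unit.
  by apply: locS; have /matrixP/(_ o o) := K1; rewrite !mxE eqxx => ->; rewrite oner_eq0.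
have := ent 1; rewrite !rmorph1 mulr1 mul1r => eqKK.
by apply: (mulIr uKo); rewrite mulrC ent eqKK.
Qed.

End Universality.

Theorem mainTheorem3 (k : finFieldType) (R : comUnitRingType)
  (piR : {rmorphism R -> k}) (HR : in_Chat piR) (n : nat) (hn : (4 <= n)%N) :
  universal_lift piR (@incl_SL R n).
Proof.
have [_ locR _ _ _] := HR.
split; first exact: incl_SL_lift.
move=> S piS [_ locS _ sepS _]; split=> [rho | f f' _ _].
  exact: lift_strict_equiv_entrywise.
exact: strict_equiv_entrywise_inj.
Qed.
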